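(* Let $\Gamma$ be a finite simplicial graph and $\mathcal{G}=\{G_u\mid u\in V(\Gamma)\}$ a collection of non-trivial finite groups indexed by $V(\Gamma)$. Then $\mathrm{Aut}(\Gamma\mathcal{G})$ satisfies Kazhdan's Property (T) if and only if $\Gamma\mathcal{G}$ is finite.
   Context: The graph product $\Gamma\mathcal{G}$ is the quotient of the free product $\ast_{u\in V(\Gamma)} G_u$ by the normal closure of all commutators $[g,h]$ with $g\in G_u$, $h\in G_v$, $\{u,v\}\in E(\Gamma)$. The vertex-groups $G_u$ are always assumed non-trivial. Groups are discrete. *)

(* Defs.v *)
From HB Require Import structures.
From mathcomp Require Import all_boot all_order all_algebra.
From mathcomp Require Import sesquilinear complex.
From mathcomp Require Import all_classical all_reals topology normedtype.

Set Implicit Arguments.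
Unset Strict Implicit.
Unset Printing Implicit Defensive.

Import Order.TTheory GRing.Theory Num.Theory.
Import numFieldNormedType.Exports.

Local Open Scope classical_set_scope.
Local Open Scope quotient_scope.
Local Open Scope group_scope.

Section FreeProduct.
Variables (I : choiceType) (G : I -> groupType).

Definition fp_word := seq {i : I & G i}.

Definition fp_letter (i : I) (g : G i) : {i : I & G i} := Tagged G g.

Inductive fp_equiv : fp_word -> fp_word -> Prop :=
| fp_equiv_refl w : fp_equiv w w
| fp_equiv_sym w1 w2 : fp_equiv w1 w2 -> fp_equiv w2 w1
| fp_equiv_trans w1 w2 w3 :
    fp_equiv w1 w2 -> fp_equiv w2 w3 -> fp_equiv w1 w3
| fp_equiv_one (i : I) (w1 w2 : fp_word) :
    fp_equiv (w1 ++ fp_letter (1 : G i) :: w2) (w1 ++ w2)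
| fp_equiv_mul (i : I) (g h : G i) (w1 w2 : fp_word) :
    fp_equiv (w1 ++ fp_letter g :: fp_letter h :: w2)
             (w1 ++ fp_letter (g * h) :: w2).

Definition fp_equivb (w1 w2 : fp_word) : bool := `[< fp_equiv w1 w2 >].

Lemma fp_equivb_refl : reflexive fp_equivb.
Proof. by move=> w; apply/asboolP; exact: fp_equiv_refl. Qed.

Lemma fp_equivb_sym : symmetric fp_equivb.
Proof. by move=> w1 w2; apply/asboolP/asboolP => /fp_equiv_sym. Qed.

Lemma fp_equivb_trans : transitive fp_equivb.
Proof.
move=> w2 w1 w3 /asboolP h12 /asboolP h23; apply/asboolP.
exact: fp_equiv_trans h12 h23.
Qed.

Definition fp_eqrel := EquivRel fp_equivb
  fp_equivb_refl fp_equivb_sym fp_equivb_trans.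

Definition free_product := {eq_quot fp_eqrel}.

HB.instance Definition _ := EqQuotient.on free_product.
HB.instance Definition _ := Choice.on free_product.

Definition fp_pi (w : fp_word) : free_product := \pi_free_product w.

Lemma fp_piP w1 w2 : fp_pi w1 = fp_pi w2 <-> fp_equiv w1 w2.
Proof.
split=> [/eqP|h]; first by rewrite eqmodE => /asboolP.
by apply/eqP; rewrite eqmodE; apply/asboolP.
Qed.

Lemma fp_repr_equiv w : fp_equiv (repr (fp_pi w)) w.
Proof. by apply/fp_piP; rewrite /fp_pi reprK. Qed.

Lemma fp_equiv_cat w1 w2 w1' w2' : fp_equiv w1 w1' -> fp_equiv w2 w2' ->
  fp_equiv (w1 ++ w2) (w1' ++ w2').
Proof.
move=> h1 h2; apply: (@fp_equiv_trans _ (w1' ++ w2)).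
- elim: h1 => {w1 w1' w2' h2}.
  + by move=> w; exact: fp_equiv_refl.
  + by move=> u v _; exact: fp_equiv_sym.
  + by move=> u v w _ + _; exact: fp_equiv_trans.
  + by move=> i u v; rewrite -!catA; exact: fp_equiv_one.
  + by move=> i g h u v; rewrite -!catA; exact: fp_equiv_mul.
- elim: h2 => {w1 h1 w2 w2'}.
  + by move=> w; exact: fp_equiv_refl.
  + by move=> u v _; exact: fp_equiv_sym.
  + by move=> u v w _ + _; exact: fp_equiv_trans.
  + by move=> i u v; rewrite !catA; exact: fp_equiv_one.
  + by move=> i g h u v; rewrite !catA; exact: fp_equiv_mul.
Qed.

Definition fp_inv_letter (x : {i : I & G i}) : {i : I & G i} :=
  fp_letter (tagged x)^-1.

Definition fp_inv_word (w : fp_word) : fp_word := rev (map fp_inv_letter w).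

Lemma fp_equiv_inv w1 w2 : fp_equiv w1 w2 ->
  fp_equiv (fp_inv_word w1) (fp_inv_word w2).
Proof.
rewrite /fp_inv_word; elim=> {w1 w2}.
- by move=> w; exact: fp_equiv_refl.
- by move=> u v _; exact: fp_equiv_sym.
- by move=> u v w _ + _; exact: fp_equiv_trans.
- move=> i u v; rewrite !map_cat /= !rev_cat rev_cons cat_rcons.
  by rewrite /fp_inv_letter /= invg1; exact: fp_equiv_one.
- move=> i g h u v; rewrite !map_cat /= !rev_cat !rev_cons !cat_rcons.
  by rewrite /fp_inv_letter /= invgM; exact: fp_equiv_mul.
Qed.

Lemma fp_equiv_mulVw w : fp_equiv (fp_inv_word w ++ w) [::].
Proof.
elim: w => [|[i g] w IHw]; first exact: fp_equiv_refl.
rewrite /fp_inv_word /= rev_cons cat_rcons -/(fp_inv_word w).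
apply: fp_equiv_trans IHw.
have := fp_equiv_mul g^-1 g (fp_inv_word w) w; rewrite mulVg.
by move/fp_equiv_trans; apply; exact: fp_equiv_one.
Qed.

Definition fp_one : free_product := fp_pi [::].
Definition fp_mul (x y : free_product) : free_product :=
  fp_pi (repr x ++ repr y).
Definition fp_inv (x : free_product) : free_product :=
  fp_pi (fp_inv_word (repr x)).

Lemma fp_mulE w1 w2 : fp_mul (fp_pi w1) (fp_pi w2) = fp_pi (w1 ++ w2).
Proof. by apply/fp_piP/fp_equiv_cat; exact: fp_repr_equiv. Qed.

Lemma fp_invE w : fp_inv (fp_pi w) = fp_pi (fp_inv_word w).
Proof. by apply/fp_piP/fp_equiv_inv/fp_repr_equiv. Qed.

Lemma fp_piW (P : free_product -> Prop) :
  (forall w, P (fp_pi w)) -> forall x, P x.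
Proof. by move=> h x; rewrite -[x]reprK; exact: h. Qed.

Lemma fp_mulA : associative fp_mul.
Proof.
elim/fp_piW=> u; elim/fp_piW=> v; elim/fp_piW=> w.
by rewrite !fp_mulE catA.
Qed.

Lemma fp_mul1 : left_id fp_one fp_mul.
Proof. by elim/fp_piW=> w; rewrite fp_mulE. Qed.

Lemma fp_mulr1 : right_id fp_one fp_mul.
Proof. by elim/fp_piW=> w; rewrite fp_mulE cats0. Qed.

Lemma fp_mulV : left_inverse fp_one fp_inv fp_mul.
Proof.
by elim/fp_piW=> w; rewrite fp_invE fp_mulE; apply/fp_piP/fp_equiv_mulVw.
Qed.

Lemma fp_mulrV : right_inverse fp_one fp_inv fp_mul.
Proof.
move=> x; rewrite -[LHS]fp_mul1 -[in LHS](fp_mulV (fp_inv x)) -fp_mulA.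
by rewrite (fp_mulA (fp_inv x)) fp_mulV fp_mul1 fp_mulV.
Qed.

HB.instance Definition _ :=
  isGroup.Build free_product fp_mulA fp_mul1 fp_mulr1 fp_mulV fp_mulrV.

Definition fp_inj (i : I) (g : G i) : free_product := fp_pi [:: fp_letter g].

End FreeProduct.

Section NormalQuotient.
Variable G : groupType.

Definition normal_subgroup (N : set G) : Prop :=
  [/\ N 1, forall x y, N x -> N y -> N (x * y),
      forall x, N x -> N x^-1 & forall x y, N x -> N (x ^ y)].

Definition normal_closure (S : set G) : set G :=
  [set x | forall N : set G, normal_subgroup N -> S `<=` N -> N x].

Lemma normal_closure_normal (S : set G) : normal_subgroup (normal_closure S).
Proof.
split=> [N [] //|x y hx hy N nN SN|x hx N nN SN|x y hx N nN SN];
  case: (nN) => [N1 NM NV NJ].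
- by apply: NM; [exact: hx|exact: hy].
- by apply: NV; exact: hx.
- by apply: NJ; exact: hx.
Qed.

Variable S : set G.

Definition nq_equivb (x y : G) : bool := `[< normal_closure S (x^-1 * y) >].

Lemma nq_equivb_refl : reflexive nq_equivb.
Proof.
move=> x; apply/asboolP; rewrite mulVg.
by case: (normal_closure_normal S).
Qed.

Lemma nq_equivb_sym : symmetric nq_equivb.
Proof.
have [_ _ NV _] := normal_closure_normal S.
by move=> x y; apply/asboolP/asboolP => /NV; rewrite invgM invgK.
Qed.

Lemma nq_equivb_trans : transitive nq_equivb.
Proof.
have [_ NM _ _] := normal_closure_normal S.
move=> y x z /asboolP hxy /asboolP hyz; apply/asboolP.
by have := NM _ _ hxy hyz; rewrite mulgA mulgK.
Qed.

Definition nq_eqrel := EquivRel nq_equivb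
  nq_equivb_refl nq_equivb_sym nq_equivb_trans.

Definition normal_quotient := {eq_quot nq_eqrel}.

HB.instance Definition _ := EqQuotient.on normal_quotient.
HB.instance Definition _ := Choice.on normal_quotient.

Definition nq_pi (x : G) : normal_quotient := \pi_normal_quotient x.

Lemma nq_piP x y : nq_pi x = nq_pi y <-> normal_closure S (x^-1 * y).
Proof.
split=> [/eqP|h]; first by rewrite eqmodE => /asboolP.
by apply/eqP; rewrite eqmodE; apply/asboolP.
Qed.

Lemma nq_repr_equiv x : normal_closure S ((repr (nq_pi x))^-1 * x).
Proof. by apply/nq_piP; rewrite /nq_pi reprK. Qed.

Definition nq_one : normal_quotient := nq_pi 1.
Definition nq_mul (x y : normal_quotient) : normal_quotient :=
  nq_pi (repr x * repr y).
Definition nq_inv (x : normal_quotient) : normal_quotient :=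
  nq_pi (repr x)^-1.

Lemma nq_mulE x y : nq_mul (nq_pi x) (nq_pi y) = nq_pi (x * y).
Proof.
have [_ NM _ NJ] := normal_closure_normal S.
apply/nq_piP; set x' := repr _; set y' := repr _.
have -> : (x' * y')^-1 * (x * y) = (x'^-1 * x) ^ y' * (y'^-1 * y).
  by rewrite /conjg invgM !mulgA mulgK.
by apply: NM; [apply: NJ|]; exact: nq_repr_equiv.
Qed.

Lemma nq_invE x : nq_inv (nq_pi x) = nq_pi x^-1.
Proof.
have [_ _ NV NJ] := normal_closure_normal S.
apply/nq_piP; set x' := repr _.
have -> : x'^-1^-1 * x^-1 = ((x'^-1 * x)^-1) ^ x'^-1.
  by rewrite /conjg invgM !invgK !mulgA mulgK.
by apply: NJ; apply: NV; exact: nq_repr_equiv.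
Qed.

Lemma nq_piW (P : normal_quotient -> Prop) :
  (forall x, P (nq_pi x)) -> forall x, P x.
Proof. by move=> h x; rewrite -[x]reprK; exact: h. Qed.

Lemma nq_mulA : associative nq_mul.
Proof.
by elim/nq_piW=> x; elim/nq_piW=> y; elim/nq_piW=> z; rewrite !nq_mulE mulgA.
Qed.

Lemma nq_mul1 : left_id nq_one nq_mul.
Proof. by elim/nq_piW=> x; rewrite nq_mulE mul1g. Qed.

Lemma nq_mulr1 : right_id nq_one nq_mul.
Proof. by elim/nq_piW=> x; rewrite nq_mulE mulg1. Qed.

Lemma nq_mulV : left_inverse nq_one nq_inv nq_mul.
Proof. by elim/nq_piW=> x; rewrite nq_invE nq_mulE mulVg. Qed.

Lemma nq_mulrV : right_inverse nq_one nq_inv nq_mul.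
Proof. by elim/nq_piW=> x; rewrite nq_invE nq_mulE mulgV. Qed.

HB.instance Definition _ :=
  isGroup.Build normal_quotient nq_mulA nq_mul1 nq_mulr1 nq_mulV nq_mulrV.

End NormalQuotient.

Section GraphProduct.
Variables (V : choiceType) (e : rel V) (G : V -> groupType).

Definition edge_commutators : set (free_product G) :=
  [set z | exists (u v : V) (g : G u) (h : G v),
     e u v /\ z = [~ fp_inj g, fp_inj h]].

Definition graph_product : groupType := normal_quotient edge_commutators.

End GraphProduct.

Section Automorphisms.
Variable G : groupType.

Record group_aut := GroupAut {
  aut_fun :> G -> G;
  aut_mulM : {morph aut_fun : x y / x * y};
  aut_bij : bijective aut_fun }.

HB.instance Definition _ := gen_eqMixin group_aut.
HB.instance Definition _ := gen_choiceMixin group_aut.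

Lemma group_aut_eq (a b : group_aut) : a =1 b -> a = b.
Proof.
case: a b => [f fM fB] [g gM gB] /= /funext fg; subst g.
by rewrite (Prop_irrelevance fM gM) (Prop_irrelevance fB gB).
Qed.

Definition aut_one : group_aut :=
  @GroupAut idfun (fun _ _ => erefl) (Bijective (fun=> erefl) (fun=> erefl)).

Lemma aut_comp_mulM (a b : group_aut) : {morph a \o b : x y / x * y}.
Proof. by move=> x y /=; rewrite !aut_mulM. Qed.

Definition aut_comp (a b : group_aut) : group_aut :=
  GroupAut (@aut_comp_mulM a b) (bij_comp (aut_bij a) (aut_bij b)).

Lemma aut_inv_ex (a : group_aut) : exists b : group_aut,
  cancel a b /\ cancel b a.
Proof.
case: (aut_bij a) => b aK bK.
have bM : {morph b : x y / x * y}.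
  by move=> x y; rewrite -[x in LHS]bK -[y in LHS]bK -aut_mulM aK.
by exists (GroupAut bM (Bijective bK aK)).
Qed.

Definition aut_inv (a : group_aut) : group_aut := sval (cid (aut_inv_ex a)).

Lemma aut_compA : associative aut_comp.
Proof. by move=> a b c; exact: group_aut_eq. Qed.

Lemma aut_comp1 : left_id aut_one aut_comp.
Proof. by move=> a; exact: group_aut_eq. Qed.

Lemma aut_compr1 : right_id aut_one aut_comp.
Proof. by move=> a; exact: group_aut_eq. Qed.

Lemma aut_compV : left_inverse aut_one aut_inv aut_comp.
Proof.
move=> a; apply: group_aut_eq => x; rewrite /aut_inv.
by case: cid => b [] /= aK _; rewrite aK.
Qed.

Lemma aut_comprV : right_inverse aut_one aut_inv aut_comp.
Proof.
move=> a; apply: group_aut_eq => x; rewrite /aut_inv.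
by case: cid => b [] /= _ bK; rewrite bK.
Qed.

HB.instance Definition _ := isGroup.Build group_aut
  aut_compA aut_comp1 aut_compr1 aut_compV aut_comprV.

End Automorphisms.

Local Open Scope ring_scope.

(* Complex Hilbert spaces; the inner product is linear in its first argument
   and conjugate-linear in the second. *)
Record hilbertSpace (R : realType) := HilbertSpace {
  hilbert_sort :> completeNormedModType R[i];
  hdot : {dot hilbert_sort for Num.conj};
  hdot_norm : forall x : hilbert_sort, hdot x x = `|x| ^+ 2 }.

(* Since pi g and pi g^-1 are mutually inverse, preservation of the inner
   product makes each pi g unitary. *)
Record unitary_rep (R : realType) (G : groupType) (H : hilbertSpace R) :=
  UnitaryRep {
    urep_fun :> G -> {linear H -> H};
    urep_1 : forall x : H, urep_fun 1%g x = x;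
    urep_M : forall (g h : G) (x : H),
      urep_fun (g * h)%g x = urep_fun g (urep_fun h x);
    urep_dot : forall (g : G) (x y : H),
      hdot H (urep_fun g x) (urep_fun g y) = hdot H x y }.

(* (Q, eps) is a Kazhdan pair: every unitary representation with a
   (Q, eps)-invariant vector has a non-zero invariant vector. *)
Definition kazhdan_pair (R : realType) (G : groupType) (Q : set G) (eps : R) :
    Prop :=
  forall (H : hilbertSpace R) (pi : unitary_rep G H),
    (exists2 x : H, x != 0 &
       forall g, Q g -> `|pi g x - x| < eps%:C%C * `|x|) ->
    exists2 x : H, x != 0 & forall g, pi g x = x.

(* Property (T) for discrete groups: the compact subset Q is a finite set. *)
Definition property_T (R : realType) (G : groupType) : Prop :=
  exists (Q : set G) (eps : R),
    [/\ finite_set Q, 0 < eps & kazhdan_pair Q eps].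

(* Main.v *)
From HB Require Import structures.
Require Import Defs.
From mathcomp Require Import all_boot all_order all_algebra all_fingroup.
From mathcomp Require Import sesquilinear complex.
From mathcomp Require Import all_classical all_reals topology normedtype.
From mathcomp Require Import ring.

Set Implicit Arguments.
Unset Strict Implicit.
Unset Printing Implicit Defensive.

Import Order.TTheory GRing.Theory Num.Theory.
Import numFieldNormedType.Exports.

(** Let W be the graph product.  If distinct vertices are always adjacent, W is
    the set of ordered products of the vertex groups, so it is finite
    (finite_complete_graph_product).  If W is finite, so is Aut W, and a finite
    group has Property (T): the average of the orbit of an almost invariant
    vector is invariant and non-zero (finite_property_T).

    Suppose now that u and v are distinct and not adjacent.  Then Aut W has a
    subgroup of finite index with a non-zero homomorphism chi to the integers,
    and such a group does not have (T): inducing the characters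
    g |-> z ^ chi g, with z of modulus 1 close to 1, gives finite-dimensional
    unitary representations with almost invariant vectors and no invariant
    vector (virtual_character_not_T).

    The homomorphism comes from a cohomology group of rank one.  Let W act on
    a finite set E so that each vertex group G w acts regularly on a subset of
    E, its block, and trivially outside; distinct blocks are disjoint, except
    that those of u and v share exactly two points.  An integer
    cocycle c : W x E -> int is a coboundary on the block of w because the
    action there is regular, and vanishes for G w outside its block because G w
    is finite.  The primitives on the blocks glue to a primitive on E as soon
    as those on the blocks of u and v agree on both common points.  So c is a
    coboundary when one integer vanishes, the value of c around the loop that
    joins the two common points through one block and back through the other
    (cocycle_loop_coboundary), and some cocycle c0 has loop value 1: a cocycle
    is a homomorphism to a wreath product, which is defined by its values on
    the vertex groups (gp_lift).

    The automorphisms phi of W that preserve the permutation action on E and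
    preserve c0 modulo 3 form a subgroup of finite index, W being finitely
    generated.  The loop value of c0 o phi is multiplicative in phi, hence is
    1 or -1, hence is 1, being 1 modulo 3.  So c0 o phi - c0 is the coboundary
    of a function t on E, unique up to constants on the orbits, and the
    difference of t at two given points of an orbit is additive in phi.  If phi
    is the conjugation by an element k that acts trivially on E, this t is
    - c0 k.  For a suitable power k of a b^-1, with a in G u and b in G v
    non-trivial, c0 k is positive at one of the common points; it is not
    constant on the orbit of that point, since its sum over the orbit is the
    value at k of a homomorphism to the integers, and W is generated by torsion
    (rank_one_aut_not_T). *)

(** * Finite-dimensional Hilbert spaces *)
Section HermitianSpace.
Local Open Scope ring_scope.
Local Open Scope classical_set_scope.
Variables (R : realType) (n : nat).
Local Notation C := R[i].

(** A copy of the row vectors: their canonical norm is the maximum norm, which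
    in general no inner product induces. *)
Definition ell2 : Type := 'rV[C]_n.
HB.instance Definition _ := GRing.Lmodule.on ell2.
HB.instance Definition _ := Vector.on ell2.

Definition ell2_dot (x y : ell2) : C := \sum_k x 0 k * (y 0 k)^*.

Lemma ell2_dot_linearl y : linear_for *%R (ell2_dot ^~ y).
Proof.
move=> a x x'; rewrite /ell2_dot mulr_sumr -big_split /=.
by apply: eq_bigr => k _; rewrite !mxE mulrDl mulrA.
Qed.

Lemma ell2_dot_linearr x : linear_for (Num.conj \; *%R) (ell2_dot x).
Proof.
move=> a y y'; rewrite /ell2_dot /= mulr_sumr -big_split /=.
by apply: eq_bigr => k _; rewrite !mxE rmorphD rmorphM mulrDr mulrCA.
Qed.

HB.instance Definition _ := bilinear_isBilinear.Build C ell2 ell2 C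
  *%R (Num.conj \; *%R) ell2_dot (pair ell2_dot_linearl ell2_dot_linearr).

Lemma ell2_dot_herm x y :
  ell2_dot x y = (-1) ^+ false * (ell2_dot y x)^*.
Proof.
rewrite mul1r /ell2_dot rmorph_sum; apply: eq_bigr => k _.
by rewrite rmorphM /= conjCK mulrC.
Qed.

HB.instance Definition _ :=
  isHermitianSesquilinear.Build C ell2 false Num.conj ell2_dot ell2_dot_herm.

Lemma ell2_dotxx x : ell2_dot x x = \sum_k `|x 0 k| ^+ 2.
Proof. by apply: eq_bigr => k _; rewrite normCK. Qed.

Lemma ell2_dot_gt0 x : x != 0 -> 0 < ell2_dot x x.
Proof.
move=> x0; rewrite ell2_dotxx lt_def sumr_ge0 ?andbT; last first.
  by move=> k _; rewrite exprn_ge0.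
apply: contraNneq x0 => /eqP; rewrite psumr_eq0; last first.
  by move=> k _; rewrite exprn_ge0.
move/allP => x0; apply/eqP/rowP => k; rewrite mxE; apply/eqP.
by have := x0 k (mem_index_enum _); rewrite sqrf_eq0 normr_eq0.
Qed.

HB.instance Definition _ := isDotProduct.Build C ell2 ell2_dot ell2_dot_gt0.

Definition ell2_form : {dot ell2 for Num.conj} := ell2_dot.

Definition ell2_norm (x : ell2) : C := sqrtC (ell2_dot x x).

Lemma ell2_normD x y : ell2_norm (x + y) <= ell2_norm x + ell2_norm y.
Proof. by rewrite (triangle_lerif ell2_form). Qed.

Lemma ell2_normZ (a : C) x : ell2_norm (a *: x) = `|a| * ell2_norm x.
Proof.
rewrite /ell2_norm (dnormZ ell2_form) sqrtCM ?nnegrE ?exprn_ge0 //.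
by rewrite sqrCK.
Qed.

Lemma ell2_norm_eq0 x : ell2_norm x = 0 -> x = 0.
Proof. by move/eqP; rewrite (sqrt_dnorm_eq0 ell2_form) => /eqP. Qed.

HB.instance Definition _ := Lmodule_isNormed.Build C ell2
  ell2_normD ell2_normZ ell2_norm_eq0.

Lemma ell2_normE (x : ell2) : `|x| ^+ 2 = \sum_k `|x 0 k| ^+ 2.
Proof. by rewrite [LHS]sqrtCK ell2_dotxx. Qed.

End HermitianSpace.

Section Completeness.
Local Open Scope ring_scope.
Local Open Scope classical_set_scope.
Variables (R : realType) (n : nat).
Local Notation C := R[i].

Definition re_row (x : ell2 R n) : 'rV[R]_n := \row_k complex.Re (x 0 k).
Definition im_row (x : ell2 R n) : 'rV[R]_n := \row_k complex.Im (x 0 k).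

Lemma re_rowB x y : re_row (x - y) = re_row x - re_row y.
Proof. by apply/rowP => k; rewrite !mxE; case: (x 0 k) (y 0 k) => ? ? []. Qed.

Lemma im_rowB x y : im_row (x - y) = im_row x - im_row y.
Proof. by apply/rowP => k; rewrite !mxE; case: (x 0 k) (y 0 k) => ? ? []. Qed.

Lemma ell2_coord_le (x : ell2 R n) k : `|x 0 k| <= `|x|.
Proof.
rewrite -ler_sqr ?nnegrE // ell2_normE (bigD1 k) //= lerDl.
by apply: sumr_ge0 => j _; rewrite exprn_ge0.
Qed.

Lemma row_norm_le (v : 'rV[R]_n) (e : R) : 0 <= e ->
  (forall k, `|v 0 k| <= e) -> `|v| <= e.
Proof.
move=> e0 ve; rewrite [`|v|]mx_normrE; apply/bigmax_leP; split=> // -[i k] _.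
by rewrite ord1; exact: ve.
Qed.

Lemma row_coord_le (v : 'rV[R]_n) k : `|v 0 k| <= `|v|.
Proof. by rewrite [`|v|]mx_normrE; exact: (le_bigmax _ _ (0, k)). Qed.

Lemma re_row_lt (x : ell2 R n) (e : R) : `|x| < e%:C%C -> `|re_row x| < e.
Proof.
move=> xe; have := normr_ge0 x; rewrite -[`|x|]RRe_real ?normr_real //.
move: xe; rewrite -[`|x|]RRe_real ?normr_real // ltcR ler0c => xe x0.
apply: le_lt_trans xe; apply: row_norm_le => // k; rewrite mxE -lecR.
apply: le_trans (normc_ge_Re _) _.
by rewrite RRe_real ?normr_real // ell2_coord_le.
Qed.

Lemma im_row_lt (x : ell2 R n) (e : R) : `|x| < e%:C%C -> `|im_row x| < e.
Proof.
move=> xe; have -> : im_row x = re_row (- 'i%C *: x).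
  apply/rowP => k; rewrite !mxE; case: (x 0 k) => a b /=.
  by rewrite oppr0 mul0r mulN1r opprK add0r.
by apply: re_row_lt; rewrite normrZ normrN complexiE normCi mul1r.
Qed.

(** With re_row_lt and im_row_lt, this makes the norm equivalent to the maximum
    of the real and imaginary parts, so that completeness can be transported
    from real row vectors.  The constant is not optimal; n.+1 rather than n
    keeps it positive. *)
Lemma ell2_norm_le (x : ell2 R n) :
  `|x| <= (n.+1%:R * (`|re_row x| + `|im_row x|))%:C%C.
Proof.
set a := _ + _.
have a0 : 0 <= a by rewrite addr_ge0.
have xa k : `|x 0 k| <= a%:C%C.
  have := row_coord_le (re_row x) k; have := row_coord_le (im_row x) k.
  rewrite !mxE /a; case: (x 0 k) => r s /= hs hr.
  apply: (@le_trans _ _ (`|r| + `|s|)%:C%C); last by rewrite lecR lerD.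
  have -> : (r +i* s)%C = r%:C%C + 'i%C * s%:C%C.
    by rewrite [LHS]complexE.
  apply: le_trans (ler_normD _ _) _.
  rewrite normrM complexiE normCi mul1r rmorphD /= lerD //.
    by rewrite normc_def /= expr0n /= addr0 sqrtr_sqr lexx.
  by rewrite normc_def /= expr0n /= addr0 sqrtr_sqr lexx.
rewrite -ler_sqr ?nnegrE ?ler0c ?mulr_ge0 //.
rewrite ell2_normE; apply: (@le_trans _ _ (\sum_(k < n) a%:C%C ^+ 2)).
  apply: ler_sum => k _; apply: lerXn2r; rewrite ?nnegrE //.
  exact: le_trans (xa k).
have aC0 : 0 <= a%:C%C :> C by rewrite ler0c.
rewrite sumr_const card_ord -[leLHS]mulr_natl rmorphM exprMn.
apply: ler_wpM2r; first exact: exprn_ge0.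
rewrite rmorph_nat -natrX ler_nat.
by rewrite expnS expn1 (leq_trans (leqnSn n)) // leq_pmulr.
Qed.

Lemma cauchy_row (f : ell2 R n -> 'rV[R]_n) (F : set_system (ell2 R n)) :
  {morph f : x y / x - y} ->
  (forall x (e : R), `|x| < e%:C%C -> `|f x| < e) ->
  ProperFilter F -> cauchy F -> cvg (f @ F).
Proof.
move=> fB f_lt FF /cauchy_ballP Fc.
apply: cauchy_cvg; apply/cauchy_ballP => e e0.
rewrite near_map2; have e0C : 0 < e%:C%C :> C by rewrite ltcR.
move: (Fc _ e0C); apply: filterS => -[x y] /=.
by rewrite -!ball_normE /= -fB; exact: f_lt.
Qed.

Lemma ell2_complete (F : set_system (ell2 R n)) :
  ProperFilter F -> cauchy F -> cvg F.
Proof.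
move=> FF Fc.
have /cvg_ex [/= p Fp] := cauchy_row re_rowB re_row_lt FF Fc.
have /cvg_ex [/= q Fq] := cauchy_row im_rowB im_row_lt FF Fc.
pose x : ell2 R n := \row_k (p 0 k +i* q 0 k)%C.
have xp : re_row x = p by apply/rowP => k; rewrite !mxE.
have xq : im_row x = q by apply/rowP => k; rewrite !mxE.
apply/cvg_ex; exists x; apply/cvgrPdist_lt => eps eps0.
have [e e0 ->] : exists2 e : R, 0 < e & eps = e%:C%C.
  have := eps0; rewrite -[eps]RRe_real ?gtr0_real // ltcR => h.
  by exists (complex.Re eps).
pose d : R := e / (n.+1%:R * 2).
have d0 : 0 < d by rewrite divr_gt0 // mulr_gt0.
move/cvgrPdist_lt : Fp => /(_ _ d0) Fp.
move/cvgrPdist_lt : Fq => /(_ _ d0) Fq.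
near=> t.
apply: le_lt_trans (ell2_norm_le _) _; rewrite ltcR re_rowB im_rowB xp xq.
have -> : e = n.+1%:R * (d + d).
  by rewrite -mulr2n -(mulr_natr d) mulrCA /d divfK // mulf_neq0 // pnatr_eq0.
rewrite ltr_pM2l ?ltr0n // ltrD //.
  by near: t.
by near: t.
Unshelve. all: by end_near. Qed.

HB.instance Definition _ := Uniform_isComplete.Build (ell2 R n) ell2_complete.

Lemma ell2_dot_norm (x : ell2 R n) : ell2_form R n x x = `|x| ^+ 2.
Proof. by rewrite ell2_normE -ell2_dotxx. Qed.

Definition ell2_hilbert : hilbertSpace R := HilbertSpace ell2_dot_norm.

End Completeness.

(** * Powers of complex numbers of modulus one *)
Section UnitCircle.
Local Open Scope ring_scope.
Variable R : realType.
Local Notation C := R[i].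
Implicit Types z : C.

Lemma norm_expfz z (m : int) : `|z| = 1 -> `|z ^ m| = 1.
Proof.
move=> z1; case: m => n.
  by rewrite normrX z1 expr1n.
by rewrite NegzE -exprnN normfV normrX z1 expr1n invr1.
Qed.

Lemma norm_exprn_sub1 z (n : nat) :
  `|z| = 1 -> `|z ^+ n - 1| <= n%:R * `|z - 1|.
Proof.
move=> z1; elim: n => [|n IHn]; first by rewrite expr0 subrr normr0 mul0r.
have -> : z ^+ n.+1 - 1 = z * (z ^+ n - 1) + (z - 1).
  by rewrite mulrBr -exprS mulr1 addrA subrK.
apply: le_trans (ler_normD _ _) _.
by rewrite normrM z1 mul1r -natr1 mulrDl mul1r lerD.
Qed.

Lemma norm_expfz_sub1 z (m : int) :
  `|z| = 1 -> `|z ^ m - 1| <= `|m|%N%:R * `|z - 1|.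
Proof.
move=> z1; case: m => n; first exact: norm_exprn_sub1.
have z0 : z != 0 by rewrite -normr_eq0 z1 oner_eq0.
rewrite NegzE -exprnN.
have -> : z ^- n.+1 - 1 = - (z ^- n.+1 * (z ^+ n.+1 - 1)).
  by rewrite mulrBr mulVf ?expf_neq0 // mulr1 opprB.
rewrite normrN normrM normfV normrX z1 expr1n invr1 mul1r abszN.
exact: norm_exprn_sub1.
Qed.

(** z ^+ n - 1 is the product of z - 1 and of a sum of n numbers close to 1. *)
Lemma exprn_neq1 z (n : nat) : `|z| = 1 -> z != 1 -> (0 < n)%N ->
  n%:R * `|z - 1| < 1 -> z ^+ n != 1.
Proof.
move=> z1 zn1 n0 small; rewrite -subr_eq0 subrX1 mulf_neq0 ?subr_eq0 //.
apply/eqP => sum0.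
have : `|\sum_(i < n) (z ^+ i - 1)| < n%:R.
  apply: (@le_lt_trans _ _ (\sum_(i < n) (n%:R * `|z - 1|))).
    apply: le_trans (ler_norm_sum _ _ _) _; apply: ler_sum => i _.
    apply: le_trans (norm_exprn_sub1 _ z1) _.
    by rewrite ler_wpM2r // ler_nat ltnW.
  by rewrite sumr_const card_ord -[ltLHS]mulr_natr gtr_pMl ?ltr0n.
rewrite big_split /= sum0 add0r sumr_const card_ord.
by rewrite normrMn normrN normr1 ltxx.
Qed.

Lemma expfz_neq1 z (m : int) : `|z| = 1 -> z != 1 -> m != 0 ->
  `|m|%N%:R * `|z - 1| < 1 -> z ^ m != 1.
Proof.
move=> z1 zn1; case: m => n n0 small.
  by apply: exprn_neq1 => //; rewrite lt0n.
by rewrite NegzE -exprnN invr_eq1; apply: exprn_neq1.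
Qed.

(** The quotient of w = 1 + i d / 2 by its conjugate, whose difference to 1 is
    i d / w^*, with |w| >= 1. *)
Lemma unit_near_one (d : R) : 0 < d ->
  exists z : C, [/\ `|z| = 1, z != 1 & `|z - 1| <= d%:C%C].
Proof.
move=> d0; pose w : C := (1 +i* (d / 2))%C.
have w1 : 1 <= `|w|.
  by apply: le_trans (normc_ge_Re w); rewrite /= normr1.
have w0 : `|w| != 0 by rewrite gt_eqF // (lt_le_trans ltr01).
have wc0 : (w^*)%C != 0 by rewrite -normr_eq0 normcJ.
have zE : w / (w^*)%C - 1 = (0 +i* d)%C / (w^*)%C.
  rewrite -[X in _ - X](divff wc0) -mulrBl; congr (_ / _).
  by rewrite /w /=; simpc; rewrite -splitr.
have nd : `|(0 +i* d)%C| = d%:C%C.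
  by rewrite normc_def /= expr0n /= add0r sqrtr_sqr gtr0_norm.
exists (w / (w^*)%C); split.
- by rewrite normf_div normcJ divff.
- rewrite -subr_eq0 zE mulf_neq0 ?invr_eq0 // -normr_eq0 nd.
  by rewrite gt_eqF // ltcR.
- rewrite zE normf_div nd normcJ ler_pdivrMr ?(lt_le_trans ltr01) //.
  by rewrite ler_peMr // ler0c ltW.
Qed.

End UnitCircle.

(** * Inducing a character from a subgroup of finite index *)
Section FiniteIndex.
Local Open Scope group_scope.
Variables (G : groupType) (L : set G).

Definition is_subgroup : Prop :=
  [/\ L 1, forall x y, L x -> L y -> L (x * y) & forall x, L x -> L x^-1].

(** L has finitely many right cosets, expressed without a type of cosets: f may
    also separate elements of the same coset. *)
Definition finite_index : Prop :=
  exists (X : finType) (f : G -> X), forall g h, f g = f h -> L (g * h^-1).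

Lemma finite_index_transversal : is_subgroup -> finite_index ->
  exists (n : nat) (cls : G -> 'I_n) (r : 'I_n -> G),
    (forall g h, cls g = cls h <-> L (g * h^-1)) /\ (forall i, cls (r i) = i).
Proof.
move=> [L1 LM LV] [X [f fL]].
(* f may separate elements of one coset; F g is the set of values of f on L g *)
pose F g : {set X} := [set x | `[< exists2 h, f h = x & L (g * h^-1) >]].
have FP g h : F g = F h <-> L (g * h^-1).
  split=> [Fgh|Lgh].
    have : f g \in F g by rewrite inE; apply/asboolP; exists g; rewrite ?mulgV.
    rewrite Fgh inE => /asboolP[k /esym/fL Lgk Lhk].
    by have := LM _ _ Lgk (LV _ Lhk); rewrite invgM invgK mulgA mulgVK.
  apply/setP => x; rewrite !inE.
  apply/asboolP/asboolP => -[k fk Lk]; exists k => //.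
    by have := LM _ _ (LV _ Lgh) Lk; rewrite invgM invgK mulgA mulgVK.
  by have := LM _ _ Lgh Lk; rewrite mulgA mulgVK.
pose s := [seq Y <- enum {set X} | `[< exists g, F g = Y >]].
have sF g : (index (F g) s < size s)%N.
  by rewrite index_mem mem_filter mem_enum andbT; apply/asboolP; exists g.
have us : uniq s by rewrite filter_uniq // enum_uniq.
pose cls g := Ordinal (sF g).
have /choice[r rP] : forall i, exists g, cls g = i.
  move=> i; have : nth (F 1) s i \in s by rewrite mem_nth.
  rewrite mem_filter => /andP[/asboolP[g gi] _]; exists g.
  by apply/val_inj; rewrite /= gi index_uniq.
exists (size s), cls, r; split=> // g h; rewrite -FP.
split=> [[]|gh]; last by apply/val_inj; rewrite /= gh.
by move/(@index_inj _ (F 1)); apply; rewrite -index_mem.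
Qed.

End FiniteIndex.

Section InducedRepresentation.
Variables (R : realType) (G : groupType) (L : set G) (chi : G -> int).
Hypothesis L_sub : is_subgroup L.
Hypothesis chiM : forall g h, L g -> L h -> chi (g * h)%g = (chi g + chi h)%R.
Variables (n : nat) (cls : G -> 'I_n) (r : 'I_n -> G).
Hypothesis clsP : forall g h, cls g = cls h <-> L (g * h^-1)%g.
Hypothesis clsK : forall i, cls (r i) = i.
Variable z : R[i].
Hypothesis z_norm : `|z|%R = 1%R.

Local Open Scope group_scope.

(** The right cosets L r_i are permuted by right multiplication; this is the
    value of chi on the element l of L such that r_i g = l r_j. *)
Definition coset_cocycle (g : G) (i : 'I_n) : int :=
  chi (r i * g * (r (cls (r i * g)))^-1).

Let L_cls g : L (g * (r (cls g))^-1).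
Proof. by apply/clsP; rewrite clsK. Qed.

Lemma cls_mul g h : cls (r (cls g) * h) = cls (g * h).
Proof. by apply/clsP; rewrite invgM mulgA mulgK; apply/clsP; rewrite clsK. Qed.

Lemma coset_cocycleM g h i : coset_cocycle (g * h) i =
  (coset_cocycle g i + coset_cocycle h (cls (r i * g)%g))%R.
Proof.
rewrite -chiM; [|exact: L_cls|exact: L_cls].
by rewrite /coset_cocycle cls_mul !mulgA mulgVK.
Qed.

Lemma coset_cocycle1 i : coset_cocycle 1 i = 0%R.
Proof.
have := coset_cocycleM 1 1 i; rewrite !mulg1 clsK => /eqP.
by rewrite -[X in X == _]GRing.addr0 (inj_eq (addrI _)) => /eqP.
Qed.

Local Open Scope ring_scope.

(** Right translation by g on the functions f on G such that
    f (l * h) = z ^ chi l * f h for l in L, in the coordinates x_i = f (r i). *)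
Definition induced_fun (g : G) (x : ell2 R n) : ell2 R n :=
  \row_i (z ^ coset_cocycle g i * x 0 (cls (r i * g)%g)).

Lemma induced_linear g : linear (induced_fun g).
Proof.
by move=> a x y; apply/rowP => i; rewrite !mxE mulrDr mulrCA.
Qed.

HB.instance Definition _ g :=
  GRing.isLinear.Build R[i] (ell2 R n) (ell2 R n) *:%R (induced_fun g)
    (induced_linear g).

Let z_neq0 : z != 0.
Proof. by rewrite -normr_eq0 z_norm oner_eq0. Qed.

Lemma induced_1 (x : ell2_hilbert R n) : induced_fun 1%g x = x.
Proof.
by apply/rowP => i; rewrite mxE coset_cocycle1 expr0z mul1r mulg1 clsK.
Qed.

Lemma induced_M (g h : G) (x : ell2_hilbert R n) :
  induced_fun (g * h)%g x = induced_fun g (induced_fun h x).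
Proof.
apply/rowP => i; rewrite !mxE coset_cocycleM expfzDr // cls_mul mulrA.
by rewrite mulgA.
Qed.

Lemma cls_bij g : bijective (fun i => cls (r i * g)%g).
Proof.
exists (fun i => cls (r i * g^-1)%g) => i; rewrite cls_mul -mulgA.
  by rewrite mulgV mulg1.
by rewrite mulVg mulg1.
Qed.

Lemma induced_dot (g : G) (x y : ell2_hilbert R n) :
  hdot (ell2_hilbert R n) (induced_fun g x) (induced_fun g y) =
  hdot (ell2_hilbert R n) x y.
Proof.
rewrite /= /ell2_dot [RHS](reindex _ (onW_bij _ (cls_bij g))) /=.
apply: eq_bigr => i _; rewrite !mxE rmorphM mulrACA -normCK.
by rewrite norm_expfz // expr1n mul1r.
Qed.

Definition induced_rep : unitary_rep G (ell2_hilbert R n) :=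
  @UnitaryRep R G (ell2_hilbert R n) induced_fun
    induced_1 induced_M induced_dot.

End InducedRepresentation.

Section VirtualCharacter.
Variables (R : realType) (G : groupType) (L : set G) (chi : G -> int).
Hypothesis L_sub : is_subgroup L.
Hypothesis L_fin : finite_index L.
Hypothesis chiM : forall g h, L g -> L h -> chi (g * h)%g = (chi g + chi h)%R.
Variable g0 : G.
Hypothesis L_g0 : L g0.
Hypothesis chi_g0 : chi g0 != 0%R.
Local Open Scope ring_scope.

(** In the representation induced from z ^ chi, the constant vector is moved
    little by any given finite set when z is close to 1.  A conjugate of g0
    multiplies any given coordinate by z ^ chi g0, which differs from 1, so an
    invariant vector vanishes. *)
Theorem virtual_character_not_T : ~ property_T R G.
Proof.
move=> [Q [eps [finQ eps0 kaz]]].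
have [n [cls [r [clsP clsK]]]] := finite_index_transversal L_sub L_fin.
pose c := coset_cocycle chi cls r.
have [s Qs] : exists s : seq G, Q = [set` s]%classic by apply/finite_seqP.
pose M := \max_(g <- s) \max_(i < n) `|c g i|%N.
have cM g i : Q g -> (`|c g i| <= M)%N.
  rewrite Qs /= => gs; apply: (@leq_trans (\max_(j < n) `|c g j|)%N).
    exact: (@leq_bigmax _ (fun j => `|c g j|%N)).
  exact: (@leq_bigmax_seq _ _ xpredT (fun h => \max_(j < n) `|c h j|)%N).
(* z is chosen within e / N of 1: M then bounds the displacement of the
   constant vector by the elements of Q, and |chi g0| <= N, e < 1 ensure that
   z ^ chi g0 differs from 1 *)
pose N := (M + `|chi g0| + 1)%N.
pose e : R := Num.min (eps / 2) (1 / 2).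
have e0 : 0 < e by rewrite lt_min !divr_gt0.
have N0 : 0 < N%:R :> R by rewrite ltr0n /N addn1.
have [z [z1 zn1 zd]] := unit_near_one (divr_gt0 e0 N0).
have small m : (m <= N)%N -> m%:R * `|z - 1| <= e%:C%C.
  move=> mN; apply: (@le_trans _ _ (N%:R * (e / N%:R)%:C%C)).
    by apply: ler_pM => //; rewrite ler_nat.
  rewrite -[X in X * _](rmorph_nat (real_complex R)) -rmorphM /=.
  by rewrite mulrC divfK // gt_eqF.
pose pi := induced_rep chiM clsP clsK z1.
have zchi : z ^ chi g0 != 1.
  apply: expfz_neq1 => //; apply: (le_lt_trans (small _ _)).
    by rewrite /N -addnA addnC -addnA leq_addr.
  by rewrite ltcR gt_min; apply/orP; right; rewrite ltr_pdivrMr // mul1r ltr1n.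
have [|x x0 pix] := kaz _ pi; last first.
  case/eqP: x0; apply/rowP => i; rewrite mxE.
  (* this conjugate of g0 fixes the i-th coset and multiplies the i-th
     coordinate by z ^ chi g0 *)
  pose g := ((r i)^-1 * g0 * r i)%g.
  have rg : (r i * g = g0 * r i)%g by rewrite /g !mulgA mulgV mul1g.
  have clsg : cls (r i * g)%g = i.
    by rewrite -[RHS]clsK rg; apply/clsP; rewrite mulgK.
  have /(congr1 (fun y : 'rV_n => y 0 i)) := pix g.
  rewrite /= mxE /coset_cocycle clsg rg mulgK => /eqP.
  rewrite -subr_eq0 -[X in _ - X]mul1r -mulrBl mulf_eq0 subr_eq0 (negPf zchi).
  by move/eqP.
pose x : ell2 R n := \row_i 1.
have i0 : 'I_n := cls 1%g.
have x0 : x != 0.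
  by apply/eqP => /rowP/(_ i0)/eqP; rewrite !mxE oner_eq0.
exists x => // g Qg.
apply: (@le_lt_trans _ _ (e%:C%C * `|x|)); last first.
  rewrite ltr_pM2r ?normr_gt0 // ltcR gt_min; apply/orP; left.
  by rewrite ltr_pdivrMr // ltr_pMr // ltr1n.
have eC0 : 0 <= e%:C%C :> R[i] by rewrite ler0c ltW.
rewrite -ler_sqr ?nnegrE ?mulr_ge0 //.
rewrite exprMn !ell2_normE mulr_sumr; apply: ler_sum => i _.
rewrite !mxE mulr1 normr1 expr1n mulr1 lerXn2r ?nnegrE //.
apply: (le_trans (norm_expfz_sub1 _ z1)); apply: small.
by apply: (leq_trans (cM _ _ Qg)); rewrite /N -addnA leq_addr.
Qed.

End VirtualCharacter.

(** * Finite groups *)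
Section FiniteGroups.
Local Open Scope ring_scope.

(** Every x with |pi g x - x| < |x| for all g has a non-zero orbit sum, since
    that sum is at distance less than the order of G times |x| from the order of
    G times x. *)
Theorem finite_property_T (R : realType) (G : groupType) :
  finite_set [set: G]%classic -> property_T R G.
Proof.
move=> finG; exists [set: G]%classic, 1; split=> // H pi [x x0 small].
have /finite_seqP[s0 s0E] := finG.
pose s := undup s0.
have us : uniq s by exact: undup_uniq.
have sG g : g \in s.
  by rewrite mem_undup; have : [set: G]%classic g by []; rewrite s0E.
pose y : H := \sum_(g <- s) pi g x.
exists y => [|h]; last first.
  rewrite /y linear_sum /=.
  under eq_bigr do rewrite -urep_M.
  rewrite -(big_map (fun g => h * g)%g xpredT (fun g => pi g x)).
  apply: perm_big; apply: uniq_perm => // [|g].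
    by rewrite map_inj_uniq //; exact: mulgI.
  rewrite sG; apply/mapP; exists (h^-1 * g)%g; first exact: sG.
  by rewrite mulVKg.
apply/eqP => y0.
have lt_x g : `|pi g x - x| < `|x| by have := small g I; rewrite mul1r.
have : `|\sum_(g <- s) (pi g x - x)| < `|x| *+ size s.
  case: s sG {us y y0} => [/(_ 1%g)//|g t _].
  rewrite big_cons /= mulrS (le_lt_trans (ler_normD _ _)) // ltr_leD //.
  apply: le_trans (ler_norm_sum _ _ _) _.
  have <- : \sum_(k <- t) `|x| = `|x| *+ size t.
    by rewrite big_const_seq count_predT iter_addr_0.
  by apply: ler_sum => k _; rewrite ltW.
rewrite sumrB -/y y0 sub0r normrN big_const_seq count_predT iter_addr_0.
by rewrite normrMn ltxx.
Qed.

End FiniteGroups.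

Lemma finite_set_group_aut (G : groupType) :
  finite_set [set: G]%classic -> finite_set [set: group_aut G]%classic.
Proof.
move=> /finite_seqP[s sE].
have sG x : x \in s by have : [set: G]%classic x by []; rewrite sE.
pose f (a : group_aut G) : (size s).-tuple 'I_(size s).+1 :=
  map_tuple (fun x => inord (index (a x) s)) (in_tuple s).
have f_inj : injective f.
  move=> a b /(congr1 val) /= /eq_in_map ab; apply: group_aut_eq => x.
  have /(congr1 val) /= := ab x (sG x).
  rewrite !inordK ?ltnS ?index_size //.
  by move/(@index_inj _ 1%g); apply; exact: sG.
rewrite -(preimage_setT f); apply: finite_preimage (finite_finset).
by move=> a b _ _; exact: f_inj.
Qed.

(** * Graph products: generation and universal property *)
Lemma nq_piM (G : groupType) (S : set G) :
  {morph @nq_pi G S : x y / (x * y)%g}.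
Proof. by move=> x y; rewrite [RHS]nq_mulE. Qed.

Lemma fp_piM (I : choiceType) (G : I -> groupType) (v w : fp_word G) :
  fp_pi (v ++ w) = (fp_pi v * fp_pi w)%g.
Proof. by rewrite [RHS]fp_mulE. Qed.

Section GraphProducts.
Local Open Scope group_scope.
Variables (V : choiceType) (e : rel V) (G : V -> groupType).
Local Notation W := (graph_product e G).
Local Notation gp_rel := (@edge_commutators V e G).

Definition gp_inj (u : V) (g : G u) : W :=
  @nq_pi _ gp_rel (fp_inj g).

Lemma gp_injM u : {morph @gp_inj u : g h / g * h}.
Proof.
move=> g h; rewrite /gp_inj -nq_piM /fp_inj -fp_piM.
by congr nq_pi; apply/fp_piP/fp_equiv_sym; exact: (fp_equiv_mul g h [::] [::]).
Qed.

Lemma gp_inj1 u : gp_inj (1 : G u) = 1.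
Proof.
by congr nq_pi; apply/fp_piP; exact: (fp_equiv_one u [::] [::]).
Qed.

Lemma gp_injX u (g : G u) n : gp_inj (g ^+ n) = gp_inj g ^+ n.
Proof. by elim: n => [|n IHn]; rewrite ?gp_inj1 // !expgS gp_injM IHn. Qed.

Lemma gp_inj_commute u v (g : G u) (h : G v) :
  e u v -> gp_inj g * gp_inj h = gp_inj h * gp_inj g.
Proof.
move=> euv; rewrite -!nq_piM; apply/esym/nq_piP => N _; apply.
exists u, v, g, h; split=> //.
by rewrite /commg /conjg invgM !mulgA.
Qed.

Lemma gp_ind (P : W -> Prop) :
  P 1 -> (forall x u (g : G u), P x -> P (x * gp_inj g)) -> forall x, P x.
Proof.
move=> P1 PM; elim/nq_piW; elim/fp_piW; elim/last_ind => [//|w [u g] IHw].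
suff -> : @nq_pi _ gp_rel (fp_pi (rcons w (existT _ u g))) =
    @nq_pi _ gp_rel (fp_pi w) * gp_inj g by exact: PM.
by rewrite -nq_piM -fp_piM cats1.
Qed.

Section Lift.
Variables (T : groupType) (f : forall u, G u -> T).
Hypothesis fM : forall u, {morph @f u : g h / g * h}.
Hypothesis f_commute : forall u v (g : G u) (h : G v), e u v ->
  f g * f h = f h * f g.

Definition fp_lift (w : fp_word G) : T := \prod_(l <- w) f (tagged l).

Lemma fp_lift_equiv w1 w2 : fp_equiv w1 w2 -> fp_lift w1 = fp_lift w2.
Proof.
elim=> {w1 w2} [//|//|w1 w2 w3 _ -> //|u w1 w2|u g h w1 w2].
- have f1 : f (1 : G u) = 1.
    by apply: (@mulgI _ (f (1 : G u))); rewrite -fM !mulg1.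
  by rewrite /fp_lift !big_cat big_cons /= f1 mul1g.
- by rewrite /fp_lift !big_cat !big_cons /= fM !mulgA.
Qed.

Lemma fp_lift_repr w : fp_lift (generic_quotient.repr (fp_pi w)) = fp_lift w.
Proof. exact/fp_lift_equiv/fp_repr_equiv. Qed.

(** The universal property of the graph product. *)
Lemma gp_lift : exists F : W -> T,
  {morph F : x y / x * y} /\ forall u (g : G u), F (gp_inj g) = f g.
Proof.
pose F1 (x : free_product G) := fp_lift (generic_quotient.repr x).
have F1M : {morph F1 : x y / x * y}.
  elim/fp_piW=> v; elim/fp_piW=> w; rewrite -fp_piM /F1 !fp_lift_repr.
  exact: big_cat.
have F1_1 : F1 1 = 1 by apply: (@mulgI _ (F1 1)); rewrite -F1M !mulg1.
have F1V x : F1 x^-1 = (F1 x)^-1.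
  by apply: (@mulgI _ (F1 x)); rewrite -F1M !mulgV.
have F1_inj u (g : G u) : F1 (fp_inj g) = f g.
  by rewrite /F1 fp_lift_repr /fp_lift big_seq1.
have F1_kernel x : normal_closure gp_rel x -> F1 x = 1.
  move=> xS; apply: (xS [set y | F1 y = 1]%classic).
    split=> [//|y z Fy Fz|y Fy|y z Fy].
    - by rewrite /= F1M Fy Fz mulg1.
    - by rewrite /= F1V Fy invg1.
    - by rewrite /= !F1M F1V Fy mul1g mulVg.
  move=> _ [u [v [g [h [euv ->]]]]] /=.
  rewrite /commg /conjg !F1M !F1V !F1_inj.
  by rewrite (f_commute _ _ euv) mulKg mulVg.
have F1_repr x : F1 (generic_quotient.repr (@nq_pi _ gp_rel x)) = F1 x.
  have := F1_kernel _ (@nq_repr_equiv _ gp_rel x).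
  by rewrite F1M F1V => /(canRL (mulVKg _)); rewrite mulg1.
exists (fun x => F1 (generic_quotient.repr x)); split=> [|u g]; last first.
  by rewrite F1_repr F1_inj.
by elim/nq_piW=> x; elim/nq_piW=> y; rewrite -nq_piM !F1_repr F1M.
Qed.

End Lift.

End GraphProducts.

(** * Complete graphs *)
Section CompleteGraph.
Local Open Scope group_scope.
Local Open Scope classical_set_scope.
Variables (V : finType) (e : rel V) (G : V -> finGroupType).
Hypothesis e_complete : forall u v, u != v -> e u v.
Local Notation W := (graph_product e G).

Fixpoint ordered_products (s : seq V) : set W :=
  if s is u :: t then
    [set x * y | x in range (@gp_inj _ e G u) & y in ordered_products t]
  else [set 1].

Lemma finite_ordered_products s : finite_set (ordered_products s).
Proof.
elim: s => [|u s IHs] /=; first exact: finite_set1.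
by apply: finite_image2 => //; apply: finite_image; exact: finite_finset.
Qed.

Lemma ordered_products1 s : ordered_products s 1.
Proof.
elim: s => [//|u s IHs] /=.
exists 1; first by exists 1 => //; exact: gp_inj1.
by exists 1; rewrite ?mulg1.
Qed.

Lemma ordered_products_commute s x u (g : G u) : u \notin s ->
  ordered_products s x -> gp_inj e g * x = x * gp_inj e g.
Proof.
elim: s x => [|v s IHs] x /=; first by move=> _ ->; rewrite mulg1 mul1g.
rewrite inE negb_or => /andP[uv us] [_ [h _ <-]] [y sy <-].
by rewrite mulgA (gp_inj_commute _ _ (e_complete uv)) -!mulgA IHs.
Qed.

(** A new letter moves to the left, past the factors at other vertices, until it
    reaches the factor at its own vertex. *)
Lemma ordered_products_mul s x u (g : G u) : uniq s -> u \in s ->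
  ordered_products s x -> ordered_products s (x * gp_inj e g).
Proof.
elim: s x => [//|v s IHs] x /= /andP[vs us].
rewrite inE => /orP[/eqP uv|u_s] [_ [h _ <-]] [y sy <-].
  subst v; exists (gp_inj e (h * g)); first by exists (h * g).
  by exists y; rewrite // gp_injM -!mulgA (ordered_products_commute _ vs sy).
exists (gp_inj e h); first by exists h.
by exists (y * gp_inj e g); [exact: IHs|rewrite mulgA].
Qed.

Theorem finite_complete_graph_product : finite_set [set: W].
Proof.
apply: sub_finite_set (finite_ordered_products (enum V)) => x _.
elim/gp_ind: x => [|x u g xV]; first exact: ordered_products1.
by apply: ordered_products_mul; rewrite ?enum_uniq ?mem_enum.
Qed.

End CompleteGraph.

(** * Cocycles of rank one and automorphisms *)
Lemma int_hom_torsion (W : groupType) (I : Type) (gen : I -> W)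
    (s : W -> int) :
  (forall P : W -> Prop, P 1%g ->
     (forall x i, P x -> P (x * gen i)%g) -> forall x, P x) ->
  (forall i, exists2 n, (0 < n)%N & (gen i ^+ n = 1)%g) ->
  (forall g h, s (g * h)%g = (s g + s h)%R) -> forall g, s g = 0%R.
Proof.
move=> genP tors sM.
have s1 : s 1%g = 0%R by apply: (@addrI _ (s 1%g)); rewrite -sM mulg1 addr0.
have sX g n : s (g ^+ n)%g = (s g *+ n)%R.
  by elim: n => [|n IHn]; rewrite ?mulr0n // expgS sM IHn mulrS.
elim/genP => [//|x i sx]; rewrite sM sx add0r.
have [n n0 /(congr1 s)] := tors i.
by rewrite sX s1 => /eqP; rewrite mulrn_eq0 eqn0Ngt n0 => /eqP.
Qed.

Section RankOne.
Variables (W : groupType) (E : finType) (theta : W -> {perm E}).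
Local Open Scope ring_scope.

(** Cocycles with values in the integer functions on E, for the right action in
    which g maps x to theta g x. *)
Definition is_cocycle (c : W -> E -> int) : Prop :=
  forall g h x, c (g * h)%g x = c g x + c h (theta g x).

Definition is_coboundary (c : W -> E -> int) : Prop :=
  exists t : E -> int, forall g x, c g x = t (theta g x) - t x.

Hypothesis thetaM : {morph theta : g h / (g * h)%g}.
Variables (I : finType) (gen : I -> W).
Hypothesis gen_ind : forall P : W -> Prop, P 1%g ->
  (forall x i, P x -> P (x * gen i)%g) -> forall x, P x.
Hypothesis gen_torsion : forall i, exists2 n, (0 < n)%N & (gen i ^+ n = 1)%g.
Variables (a b : W) (x0 : E).
Hypothesis theta_ab : theta a x0 = theta b x0.
(** a b^-1 closes a loop at x0, and the value of a cocycle on this loop decides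
    whether it is a coboundary. *)
Hypothesis rank_one : forall c, is_cocycle c -> c a x0 = c b x0 ->
  is_coboundary c.
Variable c0 : W -> E -> int.
Hypothesis c0_cocycle : is_cocycle c0.
Hypothesis c0_loop : c0 a x0 - c0 b x0 = 1.

Let theta1 : theta 1%g = 1%g.
Proof. by apply: (@mulgI _ (theta 1%g)); rewrite -thetaM !mulg1. Qed.

Let thetaV g : theta g^-1%g = (theta g)^-1%g.
Proof. by apply: (@mulgI _ (theta g)); rewrite -thetaM !mulgV. Qed.

Let c0_1 x : c0 1%g x = 0.
Proof.
have := c0_cocycle 1%g 1%g x; rewrite mulg1 theta1 perm1 => /eqP.
by rewrite -[X in X == _]addr0 (inj_eq (addrI _)) => /eqP.
Qed.

Let c0V g x : c0 g^-1%g (theta g x) = - c0 g x.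
Proof.
by apply/eqP; rewrite -addr_eq0 addrC -c0_cocycle mulgV c0_1.
Qed.

(** Preserving theta and c0 modulo 3 is a condition on finitely many values in
    finite sets, one for each generator, so this subgroup has finite index.  The
    modulus 3 separates 1 from -1, the possible loop values of c0 o phi. *)
Definition level_aut : set (group_aut W) := [set phi : group_aut W |
  forall g, theta (phi g) = theta g /\
    forall x, (c0 (phi g) x)%:~R = (c0 g x)%:~R :> 'Z_3]%classic.

Let autVK (phi : group_aut W) g : phi (phi^-1%g g) = g.
Proof. by rewrite -[LHS]/((phi * phi^-1)%g g) mulgV. Qed.

Let autM (phi psi : group_aut W) g : (phi * psi)%g g = phi (psi g).
Proof. by []. Qed.

Let aut1 (phi : group_aut W) : phi 1%g = 1%g.
Proof. by apply: (@mulgI _ (phi 1%g)); rewrite -aut_mulM !mulg1. Qed.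

Lemma level_aut_subgroup : is_subgroup level_aut.
Proof.
split=> [g//|phi psi phiL psiL g|phi phiL g].
  have [t1 c1] := phiL (psi g); have [t2 c2] := psiL g.
  by split=> [|x]; [rewrite -t2 -t1|rewrite -c2 -c1].
have [t c] := phiL (phi^-1%g g); rewrite autVK in t c.
by split=> [|x]; [rewrite t|rewrite c].
Qed.

Lemma level_aut_finite_index : finite_index level_aut.
Proof.
pose f (phi : group_aut W) : {ffun I -> {perm E} * {ffun E -> 'Z_3}} :=
  [ffun i => (theta (phi (gen i)), [ffun x => (c0 (phi (gen i)) x)%:~R])].
exists _, f.
move=> phi psi /ffunP eq_gen.
suff eq_all g : theta (phi g) = theta (psi g) /\
    forall x, (c0 (phi g) x)%:~R = (c0 (psi g) x)%:~R :> 'Z_3.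
  by move=> g; have := eq_all (psi^-1%g g); rewrite autVK.
elim/gen_ind: g => [|g i [tg cg]]; first by rewrite !aut1.
have := eq_gen i; rewrite !ffunE => -[ti /ffunP ci].
rewrite !aut_mulM !thetaM tg ti; split=> // x.
rewrite !c0_cocycle !rmorphD /= cg tg; congr (_ + _).
by have := ci (theta (psi g) x); rewrite !ffunE.
Qed.

Definition loop_value (phi : group_aut W) : int :=
  c0 (phi a) x0 - c0 (phi b) x0.

(** The loop value of c0 o phi - loop_value phi * c0 is 0. *)
Lemma level_aut_cohomologous phi : level_aut phi -> exists t : E -> int,
  forall g x, c0 (phi g) x = loop_value phi * c0 g x + (t (theta g x) - t x).
Proof.
move=> phiL.
have [||t tP] := @rank_one (fun g x => c0 (phi g) x - loop_value phi * c0 g x).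
- move=> g h x; rewrite aut_mulM !c0_cocycle (phiL g).1.
  by rewrite mulrDr opprD addrACA.
- have -> : c0 a x0 = 1 + c0 b x0 by rewrite -c0_loop subrK.
  by rewrite /loop_value; ring.
- by exists t => g x; rewrite -tP addrC subrK.
Qed.

Lemma loop_valueM phi psi : level_aut phi -> level_aut psi ->
  loop_value (phi * psi)%g = loop_value phi * loop_value psi.
Proof.
move=> phiL psiL; have [t tP] := level_aut_cohomologous phiL.
rewrite {1 3}/loop_value !autM !tP (psiL a).1 (psiL b).1 theta_ab; ring.
Qed.

Lemma loop_value1 phi : level_aut phi -> loop_value phi = 1.
Proof.
move=> phiL; have [_ _ LV] := level_aut_subgroup.
have : loop_value phi * loop_value phi^-1%g = 1.
  rewrite -loop_valueM //; last exact: LV.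
  by rewrite mulgV /loop_value c0_loop.
have : (loop_value phi)%:~R = 1 :> 'Z_3.
  by rewrite rmorphB /= (phiL a).2 (phiL b).2 -rmorphB /= c0_loop.
(* an invertible integer congruent to 1 modulo 3 *)
move=> mod3 /(congr1 absz); rewrite abszM => /eqP; rewrite muln_eq1.
case/andP=> /eqP abs1 _; move: (loop_value phi) abs1 mod3.
by case=> [n /= -> //|n [->] /(congr1 val)].
Qed.

(** The difference of t between theta g1 x0 and x0, where c0 o phi - c0 is the
    coboundary of t. *)
Definition aut_character (g1 : W) (phi : group_aut W) : int :=
  c0 (phi g1) x0 - c0 g1 x0.

Lemma aut_characterM (g1 : W) phi psi : level_aut phi -> level_aut psi ->
  aut_character g1 (phi * psi)%g = aut_character g1 phi + aut_character g1 psi.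
Proof.
move=> phiL psiL; have [t tP] := level_aut_cohomologous phiL.
rewrite /aut_character autM !tP loop_value1 // (psiL g1).1; ring.
Qed.


(** It remains to find an automorphism on which the character does not vanish:
    conjugation by a power k of the loop a b^-1 that acts trivially on E.  The
    function c0 k is positive at x0, and it has sum 0 over the orbit of x0
    because W is generated by torsion, so it takes another value at some point
    theta w x0 of this orbit. *)
Theorem rank_one_aut_not_T (R : realType) : ~ property_T R (group_aut W).
Proof.
(* the cube makes c0 k divisible by 3, so that conjugation by k
   preserves c0 modulo 3 *)
pose p := (a * b^-1)%g; pose k := (p ^+ #[theta p] ^+ 3)%g.
have theta_p : theta p x0 = x0.
  by rewrite thetaM thetaV permM theta_ab permK.
have c0_p : c0 p x0 = 1.
  by rewrite c0_cocycle theta_ab c0V c0_loop.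
have thetaX g n : theta (g ^+ n)%g = (theta g ^+ n)%g.
  by elim: n => [|n IHn]; rewrite ?theta1 // expgS thetaM IHn -expgS.
have theta_pm : theta (p ^+ #[theta p])%g = 1%g by rewrite thetaX expg_order.
have theta_k : theta k = 1%g by rewrite thetaX theta_pm expg1n.
have c0_pX n : c0 (p ^+ n)%g x0 = n%:R.
  elim: n => [|n IHn]; first by rewrite c0_1.
  by rewrite expgS c0_cocycle theta_p c0_p IHn -natr1 addrC.
have c0_kE x : c0 k x = 3 * c0 (p ^+ #[theta p])%g x.
  rewrite /k; set q := (p ^+ _)%g in theta_pm *.
  by rewrite !expgS expg0 mulg1 !c0_cocycle theta_pm !perm1; ring.
have c0_k : 0 < c0 k x0 by rewrite c0_kE c0_pX mulr_gt0 // ltr0n order_gt0.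
pose O : {set E} := [set x | `[< exists g, theta g x0 = x >]].
have O_theta g x : (theta g x \in O) = (x \in O).
  rewrite !inE; apply/asboolP/asboolP => -[h hx].
    by exists (h * g^-1)%g; rewrite thetaM permM hx thetaV permK.
  by exists (h * g)%g; rewrite thetaM permM hx.
(* summing a cocycle over an invariant set gives a homomorphism to int *)
have sum0 : \sum_(x in O) c0 k x = 0.
  apply: (@int_hom_torsion _ _ _ (fun h => \sum_(x in O) c0 h x)
    gen_ind gen_torsion) => g h.
  under eq_bigr do rewrite c0_cocycle.
  rewrite big_split /=; congr (_ + _).
  rewrite [RHS](reindex_inj (@perm_inj _ (theta g))) /=.
  by apply: eq_bigl => x; rewrite O_theta.
(* a constant positive c0 k on the orbit O of x0 would have a positive sum *)
have [w w_k] : exists g, c0 k (theta g x0) != c0 k x0.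
  apply: contrapT => const; have : 0 < \sum_(x in O) c0 k x.
    rewrite (bigD1 x0) /=; last first.
      by rewrite inE; apply/asboolP; exists 1%g; rewrite theta1 perm1.
    rewrite ltr_pwDl // sumr_ge0 // => x /andP[+ _].
    rewrite inE => /asboolP[g <-]; rewrite ltW //.
    suff -> : c0 k (theta g x0) = c0 k x0 by [].
    by apply: contrapT => /eqP neq; apply: const; exists g.
  by rewrite sum0 ltxx.
clearbody k.
have conjM : {morph (fun g => k * g * k^-1)%g : g h / (g * h)%g}.
  by move=> g h /=; rewrite !mulgA mulgVK.
have conj_bij : bijective (fun g => k * g * k^-1)%g.
  exists (fun g => k^-1 * g * k)%g => g /=.
    by rewrite !mulgA mulVg mul1g mulgVK.
  by rewrite !mulgA mulgV mul1g mulgK.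
pose phi := GroupAut conjM conj_bij.
(* for this phi, c0 o phi - c0 is minus the coboundary of c0 k *)
have c0_phi g x : c0 (phi g) x = c0 k x + c0 g x - c0 k (theta g x).
  rewrite /= !c0_cocycle thetaM theta_k mul1g perm1; congr (_ + _).
  by rewrite -c0V theta_k perm1.
have phiL : level_aut phi.
  move=> g; split=> [|x].
    by rewrite /= !thetaM thetaV theta_k mul1g invg1 mulg1.
  rewrite c0_phi !c0_kE !rmorphB !rmorphD !rmorphM /=.
  by rewrite (_ : 3%:~R = 0 :> 'Z_3) ?mul0r ?subr0 ?add0r //; apply/val_inj.
apply: (virtual_character_not_T level_aut_subgroup level_aut_finite_index
  (@aut_characterM w) phiL).
rewrite /aut_character c0_phi addrAC addrK subr_eq0 eq_sym.
exact: w_k.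
Qed.

End RankOne.

(** * Regular actions on blocks, with a coboundary *)
Section WreathProduct.
Local Open Scope group_scope.
Variable E : finType.

(** A homomorphism from a group to the wreath product of the integers by the
    permutations of E is an action on E with an integer cocycle. *)
Definition wreath : Type := {perm E} * {ffun E -> int}.
HB.instance Definition _ := Choice.on wreath.

Definition wreath_one : wreath := (1, [ffun=> 0%R]).
Definition wreath_mul (p q : wreath) : wreath :=
  (p.1 * q.1, [ffun x => (p.2 x + q.2 (p.1 x))%R]).
Definition wreath_inv (p : wreath) : wreath :=
  (p.1^-1, [ffun x => (- p.2 ((p.1^-1)%g x))%R]).

Lemma wreath_eq (p q : wreath) : p.1 = q.1 -> p.2 =1 q.2 -> p = q.
Proof. by case: p q => [s c] [t d] /= -> /ffunP ->. Qed.

Lemma wreath_mulA : associative wreath_mul.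
Proof.
move=> p q r; apply: wreath_eq => [|x] /=; first exact: mulgA.
by rewrite !ffunE /= permM addrA.
Qed.

Lemma wreath_mul1 : left_id wreath_one wreath_mul.
Proof.
move=> p; apply: wreath_eq => [|x] /=; first exact: mul1g.
by rewrite !ffunE perm1 add0r.
Qed.

Lemma wreath_mulr1 : right_id wreath_one wreath_mul.
Proof.
move=> p; apply: wreath_eq => [|x] /=; first exact: mulg1.
by rewrite !ffunE addr0.
Qed.

Lemma wreath_mulV : left_inverse wreath_one wreath_inv wreath_mul.
Proof.
move=> p; apply: wreath_eq => [|x] /=; first exact: mulVg.
by rewrite !ffunE addNr.
Qed.

Lemma wreath_mulrV : right_inverse wreath_one wreath_inv wreath_mul.
Proof.
move=> p; apply: wreath_eq => [|x] /=; first exact: mulgV.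
by rewrite !ffunE permK addrN.
Qed.

HB.instance Definition _ := isGroup.Build wreath
  wreath_mulA wreath_mul1 wreath_mulr1 wreath_mulV wreath_mulrV.

Lemma wreath_mul2 (p q : wreath) x :
  (p * q).2 x = (p.2 x + q.2 (p.1 x))%R.
Proof. exact: ffunE. Qed.

Section BlockAction.
Variables (K : finGroupType) (j : K -> E).
Hypothesis j_inj : injective j.

(** The right regular action of K, transported to the image of j and extended
    by the identity. *)
Definition block_fun (g : K) (x : E) : E :=
  if [pick y | j y == x] is Some y then j (y * g) else x.

Lemma block_fun_in g y : block_fun g (j y) = j (y * g).
Proof.
rewrite /block_fun; case: pickP => [z /eqP/j_inj ->//|/(_ y)].
by rewrite eqxx.
Qed.

Lemma block_fun_out g x : (forall y, j y != x) -> block_fun g x = x.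
Proof.
by move=> jx; rewrite /block_fun; case: pickP => // z; rewrite (negPf (jx z)).
Qed.

Lemma block_cases x : (exists y, x = j y) \/ (forall y, j y != x).
Proof.
case: (pickP (fun y => j y == x)) => [y /eqP <-|jx]; first by left; exists y.
by right=> y; rewrite jx.
Qed.

Lemma block_funM g h x : block_fun (g * h) x = block_fun h (block_fun g x).
Proof.
have [[y ->]|jx] := block_cases x; first by rewrite !block_fun_in mulgA.
by rewrite !block_fun_out.
Qed.

Lemma block_fun_inj g : injective (block_fun g).
Proof.
apply: (can_inj (g := block_fun g^-1)) => x; rewrite -block_funM mulgV.
have [[y ->]|jx] := block_cases x; first by rewrite block_fun_in mulg1.
by rewrite block_fun_out.
Qed.

Definition block_elt (t : E -> int) (g : K) : wreath :=
  (perm (@block_fun_inj g), [ffun x => (t (block_fun g x) - t x)%R]).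

Lemma block_eltM t : {morph block_elt t : g h / g * h}.
Proof.
move=> g h; apply: wreath_eq => [|x].
  by apply/permP => x; rewrite permM !permE block_funM.
rewrite !ffunE /= permE block_funM; ring.
Qed.

End BlockAction.

Lemma block_elt_commute (K K' : finGroupType) (j : K -> E) (j' : K' -> E)
    (j_inj : injective j) (j_inj' : injective j') (t t' : E -> int) g h :
  (forall y y', j y != j' y') ->
  block_elt j_inj t g * block_elt j_inj' t' h =
  block_elt j_inj' t' h * block_elt j_inj t g.
Proof.
move=> jj'.
have fix_j y : block_fun j' h (j y) = j y.
  by apply: block_fun_out => y'; rewrite eq_sym.
have fix_j' y : block_fun j g (j' y) = j' y by apply: block_fun_out => y'.
apply: wreath_eq => [|x]; first apply/permP => x.
  rewrite !permM !permE.
  have [[y ->]|jx] := block_cases j x.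
    by rewrite block_fun_in // !fix_j block_fun_in.
  have [[y ->]|jx'] := block_cases j' x; last first.
    by rewrite !(block_fun_out _ jx, block_fun_out _ jx').
  by rewrite block_fun_in // !fix_j' block_fun_in.
rewrite !wreath_mul2 /= !permE !ffunE.
have [[y ->]|jx] := block_cases j x.
  by rewrite block_fun_in // !fix_j !subrr addr0 add0r block_fun_in.
have [[y ->]|jx'] := block_cases j' x; last first.
  by rewrite !(block_fun_out _ jx, block_fun_out _ jx') !subrr.
by rewrite block_fun_in // !fix_j' !subrr addr0 add0r block_fun_in.
Qed.

End WreathProduct.

(** * A pair of non-adjacent vertices *)
Section NonCompleteGraph.
Local Open Scope group_scope.
Variables (V : finType) (e : rel V) (G : V -> finGroupType).
Hypothesis e_sym : symmetric e.
Hypothesis e_irr : irreflexive e.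
Variables (u v : V) (a : G u) (b : G v).
Hypothesis uv : u != v.
Hypothesis nuv : ~~ e u v.
Hypothesis a1 : a != 1.
Hypothesis b1 : b != 1.
Local Notation W := (graph_product e G).
Local Notation E := {w : V & G w}.

Let letter w (g : G w) : E := Tagged G g.

(** E is the disjoint union of the vertex groups.  The block of w is a copy of
    G w in E, and glue makes those of u and v meet in exactly two points by
    identifying the unit of G v with that of G u, and b with a. *)
Definition glue (l : E) : E :=
  if l == letter (1 : G v) then letter (1 : G u)
  else if l == letter b then letter a else l.

Lemma tag_glue l : tag (glue l) = tag l \/ (tag l = v /\ tag (glue l) = u).
Proof.
rewrite /glue.
by case: eqP => [->|_]; [right|case: eqP => [->|_]; [right|left]].
Qed.

Lemma glue_id l : tag l != v -> glue l = l.
Proof.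
move=> lv; rewrite /glue; case: eqP => [lv1|_].
  by rewrite lv1 eqxx in lv.
by case: eqP => // lvb; rewrite lvb eqxx in lv.
Qed.

Lemma glue1 : glue (letter (1 : G v)) = letter (1 : G u).
Proof. by rewrite /glue eqxx. Qed.

Lemma glue_b : glue (letter b) = letter a.
Proof. by rewrite /glue eq_Tagged (negPf b1) eqxx. Qed.

Definition block w (g : G w) : E := glue (letter g).

Lemma block_inj w : injective (@block w).
Proof.
move=> g h; rewrite /block; have [wv|wv] := eqVneq w v; last first.
  by rewrite !glue_id // => /eqP; rewrite eq_Tagged => /eqP.
subst w; rewrite /glue !eq_Tagged /=.
have uvl (x : G u) (y : G v) : letter x != letter y.
  by apply: contra_neq uv => /(congr1 tag).
have uvr (x : G u) (y : G v) : letter y != letter x by rewrite eq_sym.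
case: (g =P 1) => [->|_]; case: (h =P 1) => [->//|_].
- case: (h =P b) => [_ /eqP|_ /eqP]; last by rewrite (negPf (uvl _ _)).
  by rewrite eq_Tagged /= eq_sym (negPf a1).
- case: (g =P b) => [_ /eqP|_ /eqP]; last by rewrite (negPf (uvr _ _)).
  by rewrite eq_Tagged /= (negPf a1).
case: (g =P b) => [->|_]; case: (h =P b) => [->//|_] /eqP.
- by rewrite (negPf (uvl _ _)).
- by rewrite (negPf (uvr _ _)).
- by rewrite eq_Tagged => /eqP.
Qed.

Lemma block_disjoint w w' (g : G w) (h : G w') :
  e w w' -> block g != block h.
Proof.
move=> ew; have ww' : w != w' by apply: contraTneq ew => ->; rewrite e_irr.
apply/eqP => /(congr1 tag) tE.
rewrite /block in tE.
case: (tag_glue (letter g)) (tag_glue (letter h)) =>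
  [tg|[/= wv tg]] [th|[/= wv' th]].
- by move: tE; rewrite tg th /= => /eqP; rewrite (negPf ww').
- by move: tE ew; rewrite tg th wv' /= => ->; rewrite (negPf nuv).
- by move: tE ew; rewrite tg th wv /= => <-; rewrite e_sym (negPf nuv).
- by rewrite wv wv' eqxx in ww'.
Qed.


(** On G u the cocycle is the coboundary of the indicator of a, and on the other
    vertex groups it is 0; around the loop it takes the value 1. *)
Let indicator w (x : E) : int := ((w == u) && (x == letter a))%:R%R.

Definition letter_elt w (g : G w) : wreath E :=
  block_elt (@block_inj w) (indicator w) g.

Let gen (l : E) : W := gp_inj e (tagged l).

Lemma gen_torsion (l : E) : exists2 n, (0 < n)%N & gen l ^+ n = 1.
Proof.
exists #[tagged l]; first exact: order_gt0.
by rewrite -gp_injX expg_order gp_inj1.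
Qed.

Section LoopRank.
Variable theta : W -> {perm E}.
Hypothesis thetaM : {morph theta : g h / g * h}.
Hypothesis theta_gen : forall w (g : G w) x,
  theta (gp_inj e g) x = block_fun (@block w) g x.

(** The blocks of u and v form a single loop, and the other blocks none. *)
Lemma cocycle_loop_coboundary (c : W -> E -> int) :
  is_cocycle theta c ->
  c (gp_inj e a) (letter (1 : G u)) = c (gp_inj e b) (letter (1 : G u)) ->
  is_coboundary theta c.
Proof.
move=> cM c_ab.
have theta1 : theta 1 = 1.
  by apply: (@mulgI _ (theta 1)); rewrite -thetaM !mulg1.
have c1 x : c 1 x = 0%R.
  apply: (@addrI _ (c 1 x)).
  by rewrite -{2}[x](perm1 x) -theta1 -cM mulg1 addr0.
(* on each block, s is the primitive of c that vanishes at the unit; s_glue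
   says that the primitives on the blocks of u and v agree on the two common
   points: at the unit both vanish, at the other point this is c_ab *)
pose s (l : E) := c (gen l) (block (1 : G (tag l))).
have s_glue l : s (glue l) = s l.
  rewrite {1}/glue; case: eqP => [->|_].
    by rewrite /s /gen /= !gp_inj1 !c1.
  by case: eqP => [->|//]; rewrite /s /gen /= /block glue1 glue_id.
have c_gen w (g : G w) x :
    c (gp_inj e g) x = (s (theta (gp_inj e g) x) - s x)%R.
  have [[y ->]|xw] := block_cases (@block w) x.
    (* on the block, c is a cocycle of the regular action, a coboundary *)
    rewrite theta_gen (block_fun_in (@block_inj w)) !s_glue.
    rewrite {1}/s /gen /= gp_injM cM theta_gen.
    by rewrite (block_fun_in (@block_inj w)) mul1g addrC addKr.
  (* off the block, g fixes x and has finite order *)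
  have gx : theta (gp_inj e g) x = x by rewrite theta_gen block_fun_out.
  have cX n : c (gp_inj e g ^+ n) x = (c (gp_inj e g) x *+ n)%R.
    by elim: n => [|n IHn]; rewrite ?c1 // expgS cM gx IHn mulrS.
  rewrite gx subrr; apply/eqP.
  have := cX #[g]; rewrite -gp_injX expg_order gp_inj1 c1 => /esym/eqP.
  by rewrite mulrn_eq0 eqn0Ngt order_gt0.
exists s; elim/gp_ind => [x|g w h IHg x].
  by rewrite c1 theta1 perm1 subrr.
by rewrite cM thetaM permM IHg c_gen addrC subrKA.
Qed.

End LoopRank.

Theorem noncomplete_aut_not_T (R : realType) :
  ~ property_T R (group_aut W).
Proof.
have letter_eltM w : {morph @letter_elt w : g h / g * h}.
  exact: block_eltM.
have letter_elt_comm w w' (g : G w) (h : G w') : e w w' ->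
    letter_elt g * letter_elt h = letter_elt h * letter_elt g.
  by move=> ew; apply: block_elt_commute => y y'; exact: block_disjoint.
have [F [FM F_inj]] := gp_lift letter_eltM letter_elt_comm.
pose theta g := (F g).1; pose c0 g x := (F g).2 x.
have thetaM : {morph theta : g h / g * h} by move=> g h; rewrite /theta FM.
have theta_gen w (g : G w) x : theta (gp_inj e g) x = block_fun (@block w) g x.
  by rewrite /theta F_inj permE.
have c0M : is_cocycle theta c0.
  by move=> g h x; rewrite /c0 FM wreath_mul2.
have xu : letter (1 : G u) = block (1 : G u) by rewrite /block glue_id.
have xv : letter (1 : G u) = block (1 : G v) by rewrite /block glue1.
apply: (@rank_one_aut_not_T W _ theta thetaM _ gen _ gen_torsion (gp_inj e a)
  (gp_inj e b) (letter (1 : G u)) _ (cocycle_loop_coboundary thetaM theta_gen)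
  c0 c0M).
- move=> P P1 PM; elim/gp_ind => // g w h Pg; exact: (PM g (letter h)).
- rewrite !theta_gen {1}xu xv !(block_fun_in (@block_inj _)) !mul1g.
  by rewrite /block glue_b glue_id.
- rewrite /c0 !F_inj !ffunE {1}xu (block_fun_in (@block_inj _)) mul1g.
  rewrite /indicator /block glue_id // !eqxx eq_Tagged /= [1 == a]eq_sym.
  by rewrite (negPf a1) [v == u]eq_sym (negPf uv) !subr0.
Qed.

End NonCompleteGraph.

Theorem mainTheorem7 (R : realType) (V : finType) (e : rel V)
    (G : V -> finGroupType)
    (e_sym : symmetric e) (e_irr : irreflexive e)
    (G_nontrivial : forall u : V, (1 < #|G u|)%N) :
  property_T R (group_aut (graph_product e G)) <->
  finite_set [set: graph_product e G]%classic.
Proof.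
split=> [T|finW]; last exact/finite_property_T/finite_set_group_aut.
have nontrivial u : exists g : G u, g != 1%g.
  have := G_nontrivial u; rewrite -cardsT cardG_gt1 => /trivgPn[g _ g1].
  by exists g.
have [complete|] := pselect (forall u v, u != v -> e u v).
  exact: finite_complete_graph_product.
move=> /existsNP[u /existsNP[v /not_implyP[uv /negP nuv]]].
have [a a1] := nontrivial u; have [b b1] := nontrivial v.
by have := noncomplete_aut_not_T e_sym e_irr uv nuv a1 b1 T.
Qed.
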